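(* Let $k$ be an algebraically closed field of characteristic zero and let $\omega:G\times G\times G\to k^\times$ be a normalized $3$-cocycle of a finite group $G$. Then the trace element of the quasi-Hopf algebra $D^\omega(G)$ is $\beta=\sum_{g\in G}\omega(g,g^{-1},g)\,e(g)\otimes1$.
   Context: A normalized $3$-cocycle is a function $\omega:G^3\to k^\times$ with $\omega(x,y,z)=1$ whenever one of $x,y,z$ is the identity, and $\omega(g,x,y)\omega(g,xy,z)\omega(x,y,z)=\omega(gx,y,z)\omega(g,x,yz)$ for all $g,x,y,z\in G$. For $g\in G$ put $$\theta_g(x,y)=\frac{\omega(g,x,y)\,\omega(x,y,(xy)^{-1}gxy)}{\omega(x,x^{-1}gx,y)},\qquad \gamma_g(x,y)=\frac{\omega(x,y,g)\,\omega(g,g^{-1}xg,g^{-1}yg)}{\omega(x,g,g^{-1}yg)}.$$ $D^\omega(G)$ (the twisted quantum double) is the quasi-Hopf algebra with underlying space $k[G]'\otimes k[G]$ with basis $e(g)\otimes x$ ($g,x\in G$; $\{e(g)\}$ the basis of the linear dual $k[G]'$ dual to $G$) and structure: $(e(g)\otimes x)(e(h)\otimes y)=\theta_g(x,y)\,\delta_{g,xhx^{-1}}\,e(g)\otimes xy$; $\Delta(e(g)\otimes x)=\sum_{hk=g}\gamma_x(h,k)\,e(h)\otimes x\otimes e(k)\otimes x$; $\Phi=\sum_{g,h,k}\omega(g,h,k)^{-1}e(g)\otimes1\otimes e(h)\otimes1\otimes e(k)\otimes1$; $\varepsilon(e(g)\otimes x)=\delta_{g,1}$; antipode $S(e(g)\otimes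 x)=\theta_{g^{-1}}(x,x^{-1})^{-1}\gamma_x(g,g^{-1})^{-1}e(x^{-1}g^{-1}x)\otimes x^{-1}$; $\alpha=1$; $\beta=\sum_{g}\omega(g,g^{-1},g)\,e(g)\otimes1$. It is a semi-simple algebra. Trace element of a finite-dimensional semi-simple quasi-Hopf algebra $H$ with data $\alpha,\beta,S$: for a basis $\{b_i\}$ of $H$ with dual basis $\{b^i\}$, the normalized left cointegral is the functional $\lambda(x)=\sum_i b^i(xS^2(b_i)S(\beta)\alpha)$; the bilinear form $(a,b)\mapsto\lambda(ab)$ is non-degenerate (known). With $\chi_{reg}$ the character of the left regular representation, the trace element is the unique $t\in H$ with $\chi_{reg}(x)=\lambda(xt)$ for all $x\in H$. *)

(* Defs.v *)
From HB Require Import structures.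
From mathcomp Require Import all_boot all_order all_algebra all_fingroup all_field.
From mathcomp Require Import ring.

Set Implicit Arguments.
Unset Strict Implicit.
Unset Printing Implicit Defensive.

Import GRing.Theory.
Import passmx.

Local Open Scope ring_scope.

(* The coordinate model of the tensor product: u (x) v is the matrix of the
   products of the coordinates of u and v. *)
Definition tensor (k : fieldType) (U V : vectType k) : vectType k :=
  'M[k]_(\dim {:U}, \dim {:V}).

Definition tens (k : fieldType) (U V : vectType k) (u : U) (v : V) :
  tensor U V := (rVof (vbasis {:U}) u)^T *m rVof (vbasis {:V}) v.

(* Structure maps and elements of a finite-dimensional quasi-Hopf algebra. The
   quasi-Hopf axioms are not fields: the notions below depend on the data only. *)
Record quasiHopfData (k : fieldType) := QuasiHopfData {
  qh_alg :> falgType k;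
  qh_comul : {linear qh_alg -> tensor qh_alg qh_alg};
  qh_counit : {linear qh_alg -> k^o};
  qh_assoc : tensor qh_alg (tensor qh_alg qh_alg);
  qh_antipode : {linear qh_alg -> qh_alg};
  qh_alpha : qh_alg;
  qh_beta : qh_alg }.

Section TraceElement.

Variables (k : fieldType) (H : quasiHopfData k).
Local Notation S := (@qh_antipode k H).
Local Notation alpha := (@qh_alpha k H).
Local Notation beta := (@qh_beta k H).
Local Notation b := (vbasis {:H}).

(* coord b i is the i-th vector of the basis dual to b; the value is the trace
   of h |-> x * S (S h) * S beta * alpha, hence does not depend on b. *)
Definition left_cointegral (x : H) : k :=
  \sum_(i < \dim {:H}) coord b i (x * S (S b`_i) * S beta * alpha).

Definition regular_character (x : H) : k := \tr (mxof b b (amull x)).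

Definition is_trace_element (t : H) : Prop :=
  forall x : H, regular_character x = left_cointegral (x * t).

End TraceElement.

Record cocycle3 (k : fieldType) (gT : finGroupType) := Cocycle3 {
  cocycle3_fun :> gT -> gT -> gT -> k;
  cocycle3_neq0 : forall x y z, cocycle3_fun x y z != 0;
  cocycle3_norm : forall x y z,
    [\/ x = 1%g, y = 1%g | z = 1%g] -> cocycle3_fun x y z = 1;
  cocycle3_eq : forall g x y z,
    cocycle3_fun g x y * cocycle3_fun g (x * y)%g z * cocycle3_fun x y z =
    cocycle3_fun (g * x)%g y z * cocycle3_fun g x (y * z)%g }.

(* k[G]' (x) k[G], through coordinates in the basis e(g) (x) x; the argument w
   makes it possible to infer the multiplication from the type. *)
Definition twisted_double (k : fieldType) (gT : finGroupType)
  (w : cocycle3 k gT) : Type := {ffun gT * gT -> k^o}.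

HB.instance Definition _ (k : fieldType) (gT : finGroupType)
  (w : cocycle3 k gT) := Vector.on (twisted_double w).

Section TwistedDouble.

Variables (k : fieldType) (gT : finGroupType) (w : cocycle3 k gT).
Implicit Types g h x y z : gT.

(* In fingroup, x ^ y is y^-1 * x * y. *)
Definition theta g x y : k :=
  w g x y * w x y (g ^ (x * y))%g / w x (g ^ x)%g y.

Definition gamma g x y : k :=
  w x y g * w g (x ^ g)%g (y ^ g)%g / w x g (y ^ g)%g.

Local Notation D := (twisted_double w).
Implicit Types a b c : D.

(* The basis vector e(g) (x) x. *)
Definition td_basis g x : D := [ffun p => (p == (g, x))%:R].

(* The linear map sending e(g) (x) x to f g x. *)
Definition td_lift (V : lmodType k) (f : gT -> gT -> V) a : V :=
  \sum_p (a p : k) *: f p.1 p.2.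

Lemma td_lift_is_linear (V : lmodType k) (f : gT -> gT -> V) :
  linear (td_lift f).
Proof.
move=> r a b; rewrite /td_lift scaler_sumr -big_split /=.
by apply: eq_bigr => p _; rewrite !ffunE scalerDl scalerA.
Qed.

HB.instance Definition _ (V : lmodType k) (f : gT -> gT -> V) :=
  GRing.isLinear.Build k D V *:%R (@td_lift V f) (td_lift_is_linear f).

Lemma td_lift_basis (V : lmodType k) (f : gT -> gT -> V) g x :
  td_lift f (td_basis g x) = f g x.
Proof.
rewrite /td_lift (bigD1 (g, x)) //= ffunE eqxx scale1r big1 ?addr0 // => p.
by rewrite ffunE => /negPf ->; rewrite scale0r.
Qed.

Lemma td_expand a : a = td_lift td_basis a.
Proof.
apply/ffunP => p; rewrite /td_lift sum_ffunE (bigD1 p) //=.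
rewrite !ffunE -surjective_pairing eqxx big1.
  by rewrite addr0 /GRing.scale /= mulr1.
move=> q; rewrite !ffunE -surjective_pairing eq_sym => /negPf ->.
by rewrite scaler0.
Qed.

Lemma td_ext (V : lmodType k) (f1 f2 : {linear D -> V}) :
  (forall g x, f1 (td_basis g x) = f2 (td_basis g x)) -> f1 =1 f2.
Proof.
move=> eqf a; rewrite (td_expand a) !linear_sum.
by apply: eq_bigr => p _; rewrite !linearZ /= eqf.
Qed.

Definition td_one : D := \sum_(g : gT) td_basis g 1%g.

Definition td_mul a b : D :=
  td_lift (fun g x => td_lift (fun h y =>
    (theta g x y * (g == (h ^ x^-1)%g)%:R) *: td_basis g (x * y)%g) b) a.

Lemma td_mul_basis g x h y :
  td_mul (td_basis g x) (td_basis h y) =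
  (theta g x y * (g == (h ^ x^-1)%g)%:R) *: td_basis g (x * y)%g.
Proof. by rewrite /td_mul !td_lift_basis. Qed.

Lemma td_mulPl r a a' b : td_mul (r *: a + a') b = r *: td_mul a b + td_mul a' b.
Proof. by rewrite /td_mul linearP. Qed.

Lemma td_mulPr r a b b' : td_mul a (r *: b + b') = r *: td_mul a b + td_mul a b'.
Proof.
pose F (p : gT * gT) := td_lift (fun h y =>
  (theta p.1 p.2 y * (p.1 == (h ^ p.2^-1)%g)%:R) *: td_basis p.1 (p.2 * y)%g).
have E c : td_mul a c = \sum_p (a p : k) *: F p c by [].
rewrite !E scaler_sumr -big_split /=.
by apply: eq_bigr => p _; rewrite /F linearP scalerDr !scalerA mulrC.
Qed.

Definition td_rmul b a : D := td_mul a b.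

HB.instance Definition _ b := GRing.isLinear.Build k D D *:%R (td_rmul b)
  (fun r a a' => td_mulPl r a a' b).
HB.instance Definition _ a := GRing.isLinear.Build k D D *:%R (td_mul a)
  (fun r b b' => td_mulPr r a b b').

Lemma td_mulZl (r : k) a b : td_mul (r *: a) b = r *: td_mul a b.
Proof. exact: (linearZ_LR (td_rmul b)). Qed.

Lemma td_mulZr (r : k) a b : td_mul a (r *: b) = r *: td_mul a b.
Proof. exact: (linearZ_LR (td_mul a)). Qed.

Lemma td_mul_suml (I : finType) (F : I -> D) b :
  td_mul (\sum_i F i) b = \sum_i td_mul (F i) b.
Proof. exact: (linear_sum (td_rmul b)). Qed.

Lemma td_mul_sumr (I : finType) (F : I -> D) a :
  td_mul a (\sum_i F i) = \sum_i td_mul a (F i).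
Proof. exact: (linear_sum (td_mul a)). Qed.

Lemma theta_cocycle g x y z :
  theta g x y * theta g (x * y)%g z =
  theta g x (y * z)%g * theta (g ^ x)%g y z.
Proof.
rewrite /theta -!conjgM mulgA.
set b := (g ^ x)%g; set c := (g ^ (x * y))%g; set d := (g ^ (x * y * z))%g.
have xb : (x * b = g * x)%g by rewrite /b /conjg mulKVg.
have yc : (y * c = b * y)%g by rewrite /c conjgM -/b /conjg mulKVg.
have zd : (z * d = c * z)%g by rewrite /d conjgM -/c /conjg mulKVg.
have e1 := cocycle3_eq w g x y z.
have e2 := cocycle3_eq w x b y z; rewrite xb in e2.
have e3 := cocycle3_eq w x y c z; rewrite yc in e3.
have e4 := cocycle3_eq w x y z d; rewrite zd in e4.
have nz := cocycle3_neq0 w.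
have f1 : w g x y = w (g * x)%g y z * w g x (y * z)%g
    / (w g (x * y)%g z * w x y z) by rewrite -e1; field; rewrite !nz.
have f2 : w (g * x)%g y z = w x b y * w x (b * y)%g z * w b y z
    / w x b (y * z)%g by rewrite e2; field; rewrite nz.
have f3 : w x y c = w (x * y)%g c z * w x y (c * z)%g
    / (w x (b * y)%g z * w y c z) by rewrite -e3; field; rewrite !nz.
have f4 : w (x * y)%g z d = w x y z * w x (y * z)%g d * w y z d
    / w x y (c * z)%g by rewrite e4; field; rewrite nz.
by rewrite f1 f2 f3 f4; field; rewrite !nz.
Qed.

Lemma td_mulA : associative td_mul.
Proof.
move=> a b c.
apply: (@td_ext _ (td_rmul (td_mul b c)) (td_rmul c \o td_rmul b)) => g x /=.
rewrite /td_rmul.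
apply: (@td_ext _ (td_mul (td_basis g x) \o td_rmul c)
  (td_rmul c \o td_mul (td_basis g x))) => h y /=.
rewrite /td_rmul.
apply: (@td_ext _ (td_mul (td_basis g x) \o td_mul (td_basis h y))
  (td_mul (td_mul (td_basis g x) (td_basis h y)))) => j z /=.
rewrite !td_mul_basis td_mulZl td_mulZr !td_mul_basis !scalerA.
rewrite mulgA; congr (_ *: _).
rewrite invMg conjgM.
have [eg | neg] := eqVneq g (h ^ x^-1)%g; last first.
  by rewrite /= mulr0n !(mulr0, mul0r).
rewrite [X in _ = _ * (_ * (nat_of_bool X)%:R)](_ : _ = (h == (j ^ y^-1)%g)); last first.
  by rewrite eg; apply: (inj_eq (@conjg_inj _ x^-1%g)).
have [_ | neh] := eqVneq h (j ^ y^-1)%g; last first.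
  by rewrite /= mulr0n !(mulr0, mul0r).
rewrite !mulr1 theta_cocycle mulrC; congr (_ * theta _ y z).
by rewrite eg conjgKV.
Qed.

Lemma theta1x g y : theta g 1%g y = 1.
Proof.
by rewrite /theta !cocycle3_norm ?mulr1 ?divr1 //;
   do ?[by apply: Or31|by apply: Or32].
Qed.

Lemma thetax1 g x : theta g x 1%g = 1.
Proof.
by rewrite /theta !cocycle3_norm ?mulr1 ?divr1 //;
   do ?[by apply: Or32|by apply: Or33].
Qed.

Lemma td_mul1 : left_id td_one td_mul.
Proof.
apply: (@td_ext _ (td_mul td_one) idfun) => h y /=.
rewrite /td_rmul /td_one td_mul_suml (bigD1 h) //= td_mul_basis.
rewrite theta1x invg1 conjg1 eqxx mulr1 scale1r mul1g big1 ?addr0 // => g.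
by rewrite td_mul_basis invg1 conjg1 => /negPf ->; rewrite mulr0 scale0r.
Qed.

Lemma td_mulr1 : right_id td_one td_mul.
Proof.
apply: (@td_ext _ (td_rmul td_one) idfun) => g x /=.
rewrite /td_rmul /td_one td_mul_sumr (bigD1 (g ^ x)%g) //= td_mul_basis.
rewrite thetax1 conjgK eqxx mulr1 scale1r mulg1 big1 ?addr0 // => h.
rewrite td_mul_basis; have [-> | _ _] := eqVneq g _.
  by rewrite conjgKV eqxx.
by rewrite mulr0 scale0r.
Qed.

Lemma td_mulDl : left_distributive td_mul +%R.
Proof. by move=> a b c; apply: (linearD (td_rmul c)). Qed.

Lemma td_mulDr : right_distributive td_mul +%R.
Proof. by move=> a b c; apply: (linearD (td_mul a)). Qed.

Lemma td_one_neq0 : td_one != 0.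
Proof.
apply/eqP => /ffunP/(_ (1%g, 1%g)); rewrite /td_one sum_ffunE !ffunE.
rewrite (bigD1 1%g) //= ffunE eqxx big1 => [|g /negPf neq].
  by move/eqP; rewrite addr0 oner_eq0.
by rewrite ffunE xpair_eqE eq_sym neq.
Qed.

HB.instance Definition _ := GRing.Zmodule_isNzRing.Build D
  td_mulA td_mul1 td_mulr1 td_mulDl td_mulDr td_one_neq0.

Lemma td_scalerAl (r : k) a b : r *: (a * b) = (r *: a) * b.
Proof. exact/esym/td_mulZl. Qed.

HB.instance Definition _ := GRing.Lmodule_isLalgebra.Build k D td_scalerAl.

Lemma td_scalerAr (r : k) a b : r *: (a * b) = a * (r *: b).
Proof. exact/esym/td_mulZr. Qed.

HB.instance Definition _ := GRing.Lalgebra_isAlgebra.Build k D td_scalerAr.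
HB.instance Definition _ := Algebra_isFalgebra.Build k D.

Definition td_comul : D -> tensor D D := td_lift (fun g x =>
  \sum_(p : gT * gT | (p.1 * p.2)%g == g)
    gamma x p.1 p.2 *: tens (td_basis p.1 x) (td_basis p.2 x)).
HB.instance Definition _ := GRing.Linear.on td_comul.

Definition td_counit : D -> k^o := td_lift (fun g x => (g == 1%g)%:R).
HB.instance Definition _ := GRing.Linear.on td_counit.

Definition td_assoc : tensor D (tensor D D) :=
  \sum_(g : gT) \sum_(h : gT) \sum_(j : gT) (w g h j)^-1 *:
    tens (td_basis g 1%g) (tens (td_basis h 1%g) (td_basis j 1%g)).

Definition td_antipode : D -> D := td_lift (fun g x =>
  ((theta g^-1%g x x^-1%g)^-1 * (gamma x g g^-1%g)^-1) *:
    td_basis (g^-1 ^ x)%g x^-1%g).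
HB.instance Definition _ := GRing.Linear.on td_antipode.

Definition td_beta : D := \sum_(g : gT) w g g^-1%g g *: td_basis g 1%g.

Definition twisted_quantum_double : quasiHopfData k :=
  @QuasiHopfData k D td_comul td_counit td_assoc td_antipode 1 td_beta.

End TwistedDouble.

(* Main.v *)
Require Import Defs.
From mathcomp Require Import all_boot all_order all_algebra all_fingroup all_field.
From mathcomp Require Import ring.

(* The identity theta_gamma_inv says that S^2 is conjugation by beta:
   beta * S (S a) = a * beta. As S beta is the inverse of beta,
   x * beta * S (S h) * S beta = x * h, and taking traces over h shows that
   beta is a trace element. In the basis e(g) (x) x, the regular character is
   |G| times the sum of the coordinates at e(g) (x) 1, and theta does not
   vanish, so the form chi_reg (a b) is non-degenerate in characteristic 0;
   uniqueness follows since beta is invertible. *)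

Import GRing.Theory.
Local Open Scope ring_scope.

(** * The regular character in coordinates *)

Section RegularCharacter.

Variables (k : fieldType) (H : quasiHopfData k).

(** This has the shape of [left_cointegral], so the two can be compared term by term. *)
Lemma regular_characterE (a : H) :
  regular_character a =
  \sum_(i < \dim {:H}) coord (vbasis {:H}) i (a * (vbasis {:H})`_i).
Proof.
rewrite /regular_character /mxtrace; apply: eq_bigr => i _.
rewrite !mxE /= lfunE /=; congr (coord _ _ (_ * _)).
exact: passmx.vecof_delta.
Qed.

Lemma regular_characterB (a c : H) :
  regular_character (a - c) = regular_character a - regular_character c.
Proof.
rewrite !regular_characterE -sumrB; apply: eq_bigr => i _.
by rewrite mulrBl linearB.
Qed.

End RegularCharacter.

(** * Identities between values of the cocycle *)

Section Cocycle.

Variables (k : fieldType) (gT : finGroupType) (w : cocycle3 k gT).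
Implicit Types g h x y z : gT.

Lemma cocycle3_1l y z : w 1%g y z = 1.
Proof. by apply: cocycle3_norm; apply: Or31. Qed.

Lemma cocycle3_1m x z : w x 1%g z = 1.
Proof. by apply: cocycle3_norm; apply: Or32. Qed.

Lemma cocycle3_1r x y : w x y 1%g = 1.
Proof. by apply: cocycle3_norm; apply: Or33. Qed.

(** The quotient of the two sides of the cocycle identity: a factor equal to 1, ready to be inserted
    in a product. *)
Definition pentagon g x y z : k :=
  w g x y * w g (x * y)%g z * w x y z / (w (g * x)%g y z * w g x (y * z)%g).

Lemma pentagon_eq1 g x y z : pentagon g x y z = 1.
Proof. by rewrite /pentagon cocycle3_eq divff // mulf_neq0 ?cocycle3_neq0. Qed.

(** In the cocycle identity at [g], [g^-1], [g], [g^-1], every other value of [w] has an argument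
    1. *)
Lemma cocycle3_invg g : w g^-1%g g g^-1%g = (w g g^-1%g g)^-1.
Proof.
have := pentagon_eq1 g g^-1%g g g^-1%g; rewrite /pentagon !(mulgV, mulVg).
rewrite cocycle3_1l cocycle3_1m cocycle3_1r !mulr1 divr1 => ww.
by apply: (mulfI (cocycle3_neq0 w g g^-1%g g)); rewrite ww divff ?cocycle3_neq0.
Qed.

Lemma theta_neq0 g x y : theta w g x y != 0.
Proof. by rewrite /theta !mulf_neq0 ?invr_neq0 ?cocycle3_neq0. Qed.

Lemma gamma1l g h : gamma w 1%g g h = 1.
Proof.
by rewrite /gamma cocycle3_1r cocycle3_1l cocycle3_1m !mulr1 divr1.
Qed.

Lemma theta_gamma_inv g x :
  theta w g^-1%g x x^-1%g * gamma w x g g^-1%g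
    * theta w (g ^ x)%g x^-1%g x * gamma w x^-1%g (g ^ x)^-1%g (g ^ x)%g =
  w g g^-1%g g / w (g ^ x)%g (g ^ x)^-1%g (g ^ x)%g.
Proof.
rewrite /theta /gamma !(mulgV, mulVg, conjg1, conjVg, conjgK).
set a := g^-1%g; set y := x^-1%g; set h := (g ^ x)%g; set H := h^-1%g.
pose u := (y * g)%g; pose v := (a * x)%g; pose z := (y * a)%g.
(* A product of equations serves as one multirule: it reduces the products among the arguments of
   [w], so that [field] sees equal values as one atom. *)
have grpE :
  ((x * u = g)%g * (y * x = 1)%g * (x * y = 1)%g * (u * x = h)%g * (h * H = 1)%g
   * (H * h = 1)%g * (u * v = 1)%g * (v * u = 1)%g * (g * v = x)%g * (v * y = a)%g
   * (x * H = v)%g * (H * y = z)%g * (y * g = u)%g * (h * y = u)%g * (a * g = 1)%g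
   * (g * a = 1)%g * (H * u = y)%g * (y * a = z)%g)%type.
  rewrite /H /h /u /v /z /a /y /conjg !(invMg, invgK) !mulgA.
  by do ![split]; rewrite ?(mulgK, mulgKV, mulgV, mulVg, mul1g, mulg1).
(* This combination of cocycle identities was found by integer linear algebra on
   the exponents of the values of w. *)
pose P := pentagon.
transitivity (w g a g / w h H h *
  (P x u x H * P x u v u * P x y a g * P g a x y * P h H h y * P h y x y
   / (P y x u x * P u x H u * P x H y g * P g v y g * P y x y g))).
  rewrite /P /pentagon !grpE.
  rewrite -/v !(cocycle3_1l, cocycle3_1m, cocycle3_1r).
  by field; rewrite !cocycle3_neq0 oner_neq0.
by rewrite /P !pentagon_eq1 !mulr1 divr1 mulr1.
Qed.

End Cocycle.

(** * Coordinates of products, and the square of the antipode *)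

Section TwistedDouble.

Variables (k : fieldType) (gT : finGroupType) (w : cocycle3 k gT).
Implicit Types (g h x y z : gT).
Local Notation D := (twisted_double w).
Implicit Types a b c : D.
Local Notation e := (td_basis w).
Local Notation S := (@td_antipode k gT w).
Local Notation beta := (td_beta w).

(** Only the terms e(g) (x) x of [a] and e(g ^ x) (x) x^-1 z of [b] contribute, so a single sum over
    [x] remains. *)
Lemma td_mulE a b g z :
  (a * b) (g, z) = \sum_x theta w g x (x^-1 * z)%g
    * ((a (g, x) : k) * b (g ^ x, x^-1 * z)%g).
Proof.
have liftE (f : gT -> gT -> D) c r : td_lift f c r = \sum_p (c p : k) * f p.1 p.2 r.
  by rewrite /td_lift sum_ffunE; apply: eq_bigr => p _; rewrite !ffunE.
rewrite [(a * b) _]liftE.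
rewrite (eq_bigr (fun p => \sum_q (a (p.1, p.2) : k) * ((b q : k) *
  (theta w p.1 p.2 q.2 * (p.1 == (q.1 ^ p.2^-1)%g)%:R
   * ((g, z) == (p.1, p.2 * q.2)%g)%:R)))) => [|p _]; last first.
  rewrite liftE mulr_sumr -surjective_pairing; apply: eq_bigr => q _.
  by rewrite !ffunE.
rewrite -(pair_bigA _ (fun g' x => \sum_q (a (g', x) : k) * ((b q : k) *
  (theta w g' x q.2 * (g' == (q.1 ^ x^-1)%g)%:R * ((g, z) == (g', x * q.2)%g)%:R)))).
rewrite (bigD1 g) //= [X in _ + X]big1 ?addr0 => [|g' /negPf neg].
  apply: eq_bigr => x _; rewrite (bigD1 (g ^ x, x^-1 * z)%g) //=.
  rewrite conjgK mulKVg !eqxx !mulr1 [X in _ + X]big1 ?addr0 => [|[h y] neq].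
    by ring.
  rewrite xpair_eqE eqxx /=.
  have [ez|] := eqVneq z (x * y)%g; last by rewrite !mulr0.
  have [eg|] := eqVneq g (h ^ x^-1)%g; last by rewrite !(mulr0, mul0r).
  by case/eqP: neq; rewrite ez eg conjgKV mulKg.
rewrite big1 // => x _; rewrite big1 // => q _.
by rewrite xpair_eqE (eq_sym g) neg !mulr0.
Qed.

(** The copy of k[G]' in [D]; it contains [1], [beta] and [S beta], and multiplication by its
    elements only rescales coordinates. *)
Definition td_diag (f : gT -> k) : D := \sum_g f g *: e g 1%g.

Lemma td_diagE f g x : td_diag f (g, x) = f g * (x == 1%g)%:R :> k.
Proof.
rewrite /td_diag sum_ffunE (bigD1 g) //= !ffunE xpair_eqE eqxx big1 ?addr0 // => h.
by rewrite !ffunE xpair_eqE eq_sym => /negPf ->; rewrite scaler0.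
Qed.

Lemma td_diag1 : 1 = td_diag (fun=> 1).
Proof. by apply: eq_bigr => g _; rewrite scale1r. Qed.

Lemma td_diag_mull f a g z : (td_diag f * a) (g, z) = f g * a (g, z) :> k.
Proof.
rewrite td_mulE (bigD1 1%g) //= td_diagE eqxx mulr1 invg1 mul1g conjg1 theta1x.
rewrite mul1r big1 ?addr0 // => x /negPf neq.
by rewrite td_diagE neq mulr0 mul0r mulr0.
Qed.

(** Here [f] is read at [g ^ z], as e(g) (x) z has a nonzero product with e(h) (x) 1 only for h = g
    ^ z. *)
Lemma td_diag_mulr f a g z :
  (a * td_diag f) (g, z) = (a (g, z) : k) * f (g ^ z)%g :> k.
Proof.
rewrite td_mulE (bigD1 z) //= td_diagE mulVg eqxx mulr1 thetax1.
rewrite mul1r big1 ?addr0 // => x /negPf neq.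
by rewrite td_diagE -eq_mulVg1 neq !mulr0.
Qed.

Lemma antipode_basis g x : S (e g x) =
  ((theta w g^-1%g x x^-1%g)^-1 * (gamma w x g g^-1%g)^-1)
    *: e (g^-1 ^ x)%g x^-1%g.
Proof. exact: td_lift_basis. Qed.

Lemma antipode_beta : S beta = td_diag (fun g => (w g g^-1%g g)^-1).
Proof.
(* [S] sends e(g) (x) 1 to e(g^-1) (x) 1, hence the reindexing by inversion. *)
rewrite /td_beta linear_sum /= (reindex_inj invg_inj) /=.
apply: eq_bigr => g _; rewrite linearZ /= antipode_basis.
rewrite invg1 thetax1 gamma1l invr1 mulr1 scale1r invgK conjg1.
by rewrite cocycle3_invg.
Qed.

Lemma mul_beta_antipode : beta * S beta = 1.
Proof.
apply/ffunP => -[g z]; rewrite antipode_beta [LHS]td_diag_mull td_diagE.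
rewrite mulrA divff ?cocycle3_neq0 // mul1r.
by rewrite td_diag1 td_diagE mul1r.
Qed.

Lemma antipode_beta_mul : S beta * beta = 1.
Proof.
apply/ffunP => -[g z]; rewrite antipode_beta [LHS]td_diag_mull.
rewrite [td_beta _ _]td_diagE mulrA mulVf ?cocycle3_neq0 // mul1r.
by rewrite td_diag1 td_diagE mul1r.
Qed.

(** On indices [S] is the involution (g, x) -> (g^-1 ^ x, x^-1); the scalars from its two
    applications multiply to the inverse of the left-hand side of [theta_gamma_inv]. *)
Lemma antipode_sqr_basis g x :
  S (S (e g x)) =
  (w (g ^ x)%g (g ^ x)^-1%g (g ^ x)%g / w g g^-1%g g) *: e g x.
Proof.
rewrite antipode_basis linearZ /= antipode_basis scalerA.
rewrite -conjVg !invgK conjgK; congr (_ *: _).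
rewrite -[RHS]invf_div -theta_gamma_inv -!invfM conjVg; congr _^-1.
by rewrite !mulrA.
Qed.

Lemma beta_antipode_sqr a : beta * S (S a) = a * beta.
Proof.
apply: (@td_ext _ _ _ _ (td_mul beta \o S \o S) (td_rmul beta)) => g x /=.
rewrite antipode_sqr_basis [LHS]td_mulZr; apply/ffunP => -[h y].
rewrite !ffunE [td_mul _ _ _]td_diag_mull [RHS]td_diag_mulr !ffunE.
have [[-> ->]|_] := eqVneq (h, y) (g, x); last by rewrite mulr0 mul0r scaler0.
rewrite mulr1 mul1r; apply: divfK; exact: cocycle3_neq0.
Qed.

(** * Traces and non-degeneracy *)

Local Notation b := (vbasis {:D}).

Lemma trace_td_basis (f : {linear D -> D}) :
  \sum_(i < \dim {:D}) coord b i (f b`_i) = \sum_p (f (e p.1 p.2) p : k).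
Proof.
transitivity (\sum_(i < \dim {:D}) \sum_p (b`_i p : k) * coord b i (f (e p.1 p.2))).
  apply: eq_bigr => i _; rewrite {1}[b`_i]td_expand !linear_sum.
  by apply: eq_bigr => p _; rewrite !linearZ.
rewrite exchange_big /=; apply: eq_bigr => p _.
rewrite {2}(coord_vbasis (memvf (f (e p.1 p.2)))) sum_ffunE.
by apply: eq_bigr => i _; rewrite !ffunE mulrC.
Qed.

Local Notation H := (twisted_quantum_double w).

Lemma left_cointegral_mul_beta (a : H) :
  left_cointegral (a * beta : H) = regular_character a.
Proof.
rewrite regular_characterE; apply: eq_bigr => i _; congr (coord _ _ _).
(* The factor removed by [mulr1] is [alpha]. *)
rewrite [LHS]mulr1 -[a * _ * _]mulrA -[a * _ * _]mulrA; congr (a * _).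
by rewrite [beta * _]beta_antipode_sqr -mulrA [_ * S _]mul_beta_antipode mulr1.
Qed.

(** Left multiplication by e(h) (x) x moves the second index z to x z, so only x = 1 has a trace;
    e(h) (x) 1 fixes e(h) (x) z for each of the |G| values of z. *)
Lemma regular_character_td (a : H) :
  regular_character a = #|gT|%:R * \sum_(g : gT) ((a : D) (g, 1%g) : k).
Proof.
rewrite regular_characterE (trace_td_basis (td_mul a)).
transitivity (\sum_(p : gT * gT) ((a : D) (p.1, 1%g) : k)).
  apply: eq_bigr => -[g z] _ /=; rewrite [LHS]td_mulE (bigD1 1%g) //=.
  rewrite theta1x mul1r !ffunE invg1 conjg1 mul1g eqxx mulr1 big1 ?addr0 // => x.
  rewrite -eq_invg1 => /negPf neq.
  have fixz : ((x^-1 * z)%g == z) = (x^-1%g == 1%g).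
    by rewrite -{2}[z]mul1g (inj_eq (mulIg z)).
  by rewrite ffunE xpair_eqE fixz neq andbF !mulr0.
rewrite -(pair_bigA _ (fun g _ => (a : D) (g, 1%g) : k)) /= mulr_sumr.
by apply: eq_bigr => g _; rewrite sumr_const mulr_natl.
Qed.

Lemma regular_character_nondeg (char_k : [pchar k] =i pred0) (a : H) :
  (forall c : H, regular_character (c * a) = 0) -> a = 0.
Proof.
move=> chi0; apply/ffunP => -[g x]; rewrite [RHS]ffunE.
(* Up to the nonzero scalar |G| theta, pairing with this vector extracts the coordinate of [a] at
   [(g, x)]. *)
have := chi0 (e (g ^ x)%g x^-1%g); rewrite regular_character_td.
rewrite (bigD1 (g ^ x)%g) //= [X in _ + X]big1 ?addr0 => [|h /negPf neq]; last first.
  by rewrite [LHS]td_mulE big1 // => y _; rewrite ffunE xpair_eqE neq mul0r mulr0.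
rewrite [X in _ * X](_ : _ = theta w (g ^ x)%g x^-1%g x * (a : D) (g, x)); last first.
  rewrite [LHS]td_mulE (bigD1 x^-1%g) //= ffunE eqxx mul1r invgK mulg1 conjgK.
  rewrite big1 ?addr0 // => y /negPf neq.
  by rewrite ffunE xpair_eqE neq andbF mul0r mulr0.
have card_neq0 : #|gT|%:R != 0 :> k.
  have /pcharf0P -> := char_k.
  by apply: lt0n_neq0; apply/card_gt0P; exists 1%g.
move=> eq0; apply: (mulfI (theta_neq0 _ _ w (g ^ x)%g x^-1%g x)).
by apply: (mulfI card_neq0); rewrite !mulr0.
Qed.

End TwistedDouble.

Theorem proposition9p2 (k : closedFieldType) (char_k : [pchar k] =i pred0)
    (gT : finGroupType) (w : cocycle3 k gT) :
  unique (@is_trace_element k (twisted_quantum_double w))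
    (\sum_(g : gT) w g g^-1%g g *: td_basis w g 1%g).
Proof.
split=> [a|t tP]; first exact/esym/left_cointegral_mul_beta.
rewrite -/(td_beta w).
(* With t = u beta, the trace property says that [c] and [c * u] have the same regular character for
   all [c]; non-degeneracy then applies to [u - 1]. *)
pose u : twisted_quantum_double w := t * td_antipode (td_beta w).
have tE : t = u * td_beta w.
  by rewrite /u -mulrA [td_antipode _ * _]antipode_beta_mul mulr1.
suff u1 : u = 1 by rewrite tE u1 mul1r.
apply/eqP; rewrite -subr_eq0; apply/eqP.
apply: regular_character_nondeg => // c.
rewrite mulrBr mulr1 regular_characterB [X in _ - X]tP tE.
by rewrite [X in _ - left_cointegral X]mulrA left_cointegral_mul_beta subrr.
Qed.
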